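(* For every prime $p$ and every integer $\alpha\ge 2$, $$S_p\left(p^{\alpha-1}\right)=\varphi\left(p^{\alpha}\right)+p .$$
   Context: $\mathbb{N}^*$ is the set of positive integers. The Smarandache function $S:\mathbb{N}^*\to\mathbb{N}^*$ is defined by $S(n)=\min\{m\in\mathbb{N}^* : n \text{ divides } m!\}$. For a prime $p$ and a positive integer $\beta$, $S_p(\beta)=S(p^{\beta})$; thus $S_p(p^{\alpha-1})=S\left(p^{(p^{\alpha-1})}\right)$. $\varphi$ is Euler's totient function. *)

(* Defs.v *)
From mathcomp Require Import all_boot.

Set Implicit Arguments.
Unset Strict Implicit.
Unset Printing Implicit Defensive.

(* The guard [0 < n ==> _] only serves to make the function total on [nat]:
   0 divides no factorial, and the value at 0 is the irrelevant 1. *)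
Lemma smarandache_ex (n : nat) :
  exists m, (0 < m) && ((0 < n) ==> (n %| m`!)).
Proof.
case: n => [|n]; first by exists 1.
by exists n.+1; rewrite /= dvdn_fact ?ltnSn.
Qed.

Definition smarandache (n : nat) : nat := ex_minn (smarandache_ex n).

Definition smarandache_prime (p beta : nat) : nat := smarandache (p ^ beta).

Lemma smarandacheP (n : nat) : 0 < n ->
  [/\ 0 < smarandache n, n %| (smarandache n)`!
    & forall m, 0 < m -> n %| m`! -> smarandache n <= m].
Proof.
move=> n_gt0; rewrite /smarandache; case: ex_minnP => s.
case/andP=> s_gt0 /implyP/(_ n_gt0) dvd_ns min_s; split=> // m m_gt0 dvd_nm.
by apply: min_s; rewrite m_gt0 dvd_nm implybT.
Qed.

(* Main.v *)
Require Import Defs.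
From mathcomp Require Import all_boot.

(** Legendre's recursion [v_p(n!) = floor(n/p) + v_p(floor(n/p)!)] makes
    [v_p(n!)] a nondecreasing function of [floor(n/p)] and yields
    [v_p(((p-1) p^k)!) = p^k - 1].  The valuation of [n!] therefore stays at
    [p^(alpha-1) - 1] from [n = (p-1) p^(alpha-1) = phi(p^alpha)] on, until the
    next multiple of [p], namely [phi(p^alpha) + p]. *)

(** Induction on [n]: both sides change only when [p] divides [n.+1], and then both grow by 1 +
    v_p((n+1)/p). *)
Lemma logn_fact_rec (p n : nat) : prime p ->
  logn p n`! = n %/ p + logn p (n %/ p)`!.
Proof.
move=> p_pr; have p_gt0 := prime_gt0 p_pr.
elim: n => [|n IHn]; first by rewrite div0n logn1.
rewrite factS lognM ?fact_gt0 // IHn divnS //.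
case: (boolP (p %| n.+1)) => [dvd_p | ndvd_p]; last first.
  by rewrite lognE p_pr (negbTE ndvd_p).
have -> : n.+1 = (n %/ p).+1 * p.
  by rewrite -[LHS](divnK dvd_p) divnS // dvd_p.
rewrite lognM // (logn_prime p p_pr) eqxx add1n factS lognM ?fact_gt0 //.
by rewrite addn1 !addSn addnCA.
Qed.

Lemma leq_logn_fact (p m n : nat) : m <= n -> logn p m`! <= logn p n`!.
Proof.
move=> le_mn; apply: dvdn_leq_log; first exact: fact_gt0.
by rewrite -(bin_fact le_mn) mulnCA dvdn_mulr.
Qed.

(** Each step of the recursion adds (p-1) p^k, and (p-1) p^k + p^k = p^(k+1). *)
Lemma logn_fact_pred_mul_exp (p k : nat) : prime p ->
  (logn p (p.-1 * p ^ k)`!).+1 = p ^ k.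
Proof.
move=> p_pr; have p_gt0 := prime_gt0 p_pr.
elim: k => [|k IHk].
  by rewrite muln1 logn_fact_rec // divn_small ?prednK // logn1.
rewrite logn_fact_rec // expnSr mulnA mulnK // -addnS IHk.
by rewrite -mulSnr prednK // mulnC.
Qed.

Theorem mainTheorem1 (p alpha : nat) (p_prime : prime p) (alpha_ge2 : 2 <= alpha) :
  smarandache_prime p (p ^ (alpha - 1)) = totient (p ^ alpha) + p.
Proof.
have p_gt0 := prime_gt0 p_prime.
case: alpha alpha_ge2 => [|[|k]] // _.
rewrite subSS subn0 totient_pfactor //= /smarandache_prime.
have vE := logn_fact_pred_mul_exp p k.+1 p_prime.
set M := p.-1 * p ^ k.
have NE : p.-1 * p ^ k.+1 = M * p by rewrite expnSr mulnA.
(* [vE] becomes M + v_p(M!) + 1 = p^(k+1). *)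
rewrite NE in vE *; rewrite logn_fact_rec // mulnK // in vE.
have [|_] := @smarandacheP (p ^ (p ^ k.+1)); first by rewrite expn_gt0 p_gt0.
move: (smarandache _) => s dvd_s min_s.
apply/eqP; rewrite eqn_leq; apply/andP; split.
  apply: min_s; first by rewrite addn_gt0 p_gt0 orbT.
  rewrite pfactor_dvdn ?fact_gt0 // logn_fact_rec // -mulSnr mulnK //.
  by rewrite -vE addSn ltnS leq_add2l leq_logn_fact.
(* If s < (M+1) p, then floor(s/p) <= M, so v_p(s!) <= M + v_p(M!) < p^(k+1). *)
rewrite leqNgt; apply/negP => lt_s; move: dvd_s.
rewrite pfactor_dvdn ?fact_gt0 // logn_fact_rec // -vE.
move: lt_s; rewrite -mulSnr -ltn_divLR // ltnS => le_sM.
by rewrite ltnNge (leq_add le_sM (leq_logn_fact p _ _ le_sM)).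
Qed.
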